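(* Let $[a_1,\ldots,a_k]_x$ be any vertex of the Farey polynomial tree, let $\Omega$ be the subtree rooted at this vertex, and set $$R=\{x \mid \text{there is a vertex } p(x)/q(x)\in\Omega \text{ for which } q(x)=0\}.$$ Then $R$ is dense in $(-\infty,-1]$.
   Context: The Farey polynomial tree is the infinite rooted binary tree whose nodes (vertices) carry rational functions $p(x)/q(x)$ (with $p,q$ polynomials), whose root is $\frac{x}{x+1}$, and where the node carrying $p/q$ has two children $\Phi_0(p/q)$ and $\Phi_1(p/q)$ given by $$\Phi_0\left(\frac{p(x)}{q(x)}\right)=\begin{cases}\dfrac{x\,q(x)}{x\,q(x)+p(x)} & p(0)\neq 0,\\[2ex] \dfrac{q(x)}{q(x)+p(x)/x} & p(0)=0,\end{cases}\qquad \Phi_1\left(\frac{p(x)}{q(x)}\right)=\begin{cases}\dfrac{x\,p(x)}{x\,q(x)+p(x)} & p(0)\neq 0,\\[2ex] \dfrac{p(x)}{q(x)+p(x)/x} & p(0)=0.\end{cases}$$ For $a_i\in\mathbb{Z}^+$ the vertices are labelled $$[a_1,\ldots,a_k]_x=\Phi_1^{a_1-1}\circ\Phi_0\circ\Phi_1^{a_2-1}\circ\Phi_0\circ\cdots\circ\Phi_1^{a_{k-1}-1}\circ\Phi_0\circ\Phi_1^{a_k-1}\left(\tfrac11\right),$$ so the root is $[2]_x=[1,1]_x$ (the function $[1]_x=\frac11$ is not a vertex). The subtree at a vertex is the tree generated by $\Phi_0$ and $\Phi_1$ starting from (and including) that vertex. ''$R$ is dense in $(-\infty,-1]$'' means that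 every point of $(-\infty,-1]$ lies in the closure of $R$; it does not assert $R\subseteq(-\infty,-1]$. *)

(* Defs.v *)
From HB Require Import structures.
From mathcomp Require Import all_boot all_order all_algebra.
From mathcomp Require Import all_classical all_reals all_analysis.

Set Implicit Arguments.
Unset Strict Implicit.
Unset Printing Implicit Defensive.

Import Order.TTheory GRing.Theory Num.Theory.
Import numFieldNormedType.Exports.

Local Open Scope classical_set_scope.
Local Open Scope ring_scope.

(** A rational function p/q is represented by the pair (p, q).  Both the test
    p(0) = 0 and the zeros of q depend on the representative: they are meant
    for p/q in lowest terms.  Starting from 1/1, [Phi0] and [Phi1] only produce
    pairs in lowest terms; see [farey_coprime] below.  The division by 'X in
    [Phi0] and [Phi1] is exact. *)
Definition ratpair (R : realType) : Type := ({poly R} * {poly R})%type.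

Definition Phi0 (R : realType) (v : ratpair R) : ratpair R :=
  let: (p, q) := v in
  if p.[0] == 0 then (q, q + p %/ 'X) else ('X * q, 'X * q + p).

Definition Phi1 (R : realType) (v : ratpair R) : ratpair R :=
  let: (p, q) := v in
  if p.[0] == 0 then (p, q + p %/ 'X) else ('X * p, 'X * q + p).

Arguments Phi0 : simpl never.
Arguments Phi1 : simpl never.

(** [farey_label R [:: a_1; ...; a_k]] is [a_1, ..., a_k]_x, for k >= 1; the
    value on the empty sequence is a dummy. *)
Fixpoint farey_label (R : realType) (a : seq nat) : ratpair R :=
  match a with
  | [::] => (1, 1)
  | [:: a1] => iter a1.-1 (@Phi1 R) (1, 1)
  | a1 :: a' => iter a1.-1 (@Phi1 R) (Phi0 (farey_label R a'))
  end.

Inductive subtree (R : realType) (v : ratpair R) : ratpair R -> Prop :=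
  | subtree_root : subtree v v
  | subtree_Phi0 w : subtree v w -> subtree v (Phi0 w)
  | subtree_Phi1 w : subtree v w -> subtree v (Phi1 w).

Definition farey_vertex (R : realType) (v : ratpair R) : Prop :=
  subtree ('X, 'X + 1) v.

Definition denom_zeros (R : realType) (v : ratpair R) : set R :=
  [set x | exists p q : {poly R}, subtree v (p, q) /\ q.[x] = 0].

Lemma farey_label_cons (R : realType) (a1 : nat) (a : seq nat) :
  a != [::] ->
  farey_label R (a1 :: a) = iter a1.-1 (@Phi1 R) (Phi0 (farey_label R a)).
Proof. by case: a. Qed.

Lemma Phi0_one (R : realType) : Phi0 ((1, 1) : ratpair R) = ('X, 'X + 1).
Proof. by rewrite /Phi0 hornerC oner_eq0 mulr1. Qed.

Lemma Phi1_one (R : realType) : Phi1 ((1, 1) : ratpair R) = ('X, 'X + 1).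
Proof. by rewrite /Phi1 hornerC oner_eq0 mulr1. Qed.

Lemma farey_vertex_iter (R : realType) n (v : ratpair R) :
  farey_vertex v -> farey_vertex (iter n (@Phi1 R) v).
Proof. by move=> vv; elim: n => //= n IH; apply: subtree_Phi1. Qed.

(** The vertices are exactly the labels other than [1]_x. *)
Lemma farey_vertexP (R : realType) (v : ratpair R) :
  farey_vertex v <->
  exists a : seq nat, [/\ a != [::], all (fun ai => 0 < ai)%N a, a != [:: 1%N]
                        & v = farey_label R a].
Proof.
split.
  elim=> [|w _ [a [a0 a1 _ ->]]|w _ [a [a0 a1 aN1 ->]]].
  - by exists [:: 2%N]; split=> //=; rewrite Phi1_one.
  - exists (1%N :: a); split=> //.
    by rewrite farey_label_cons.
  case: a a0 a1 aN1 => // b a _ /= /andP[b0 a1] aN1.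
  exists (b.+1 :: a); split=> //.
    by apply/eqP => -[b00]; rewrite b00 in b0.
  by case: b b0 {aN1} => // b _; case: a a1.
case=> a [+ + + ->]; elim: a => // b a IH _ /andP[b0 a1] aN1.
have [aE|aN0] := eqVneq a [::].
  rewrite aE in aN1 *; case: b b0 aN1 => // -[//|b] _ _.
  rewrite /= -iterS iterSr Phi1_one.
  exact/farey_vertex_iter/subtree_root.
rewrite farey_label_cons//; apply: farey_vertex_iter.
have [->|aN1'] := eqVneq a [:: 1%N].
  by rewrite /= Phi0_one; apply: subtree_root.
exact/subtree_Phi0/IH.
Qed.

Lemma farey_coprime (R : realType) (v : ratpair R) :
  farey_vertex v -> coprimep v.1 v.2.
Proof.
suff H : farey_vertex v ->
    [/\ coprimep v.1 v.2, forall i, 0 <= v.1`_i & forall i, 0 <= v.2`_i].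
  by case/H.
have XE (p : {poly R}) : p.[0] = 0 -> exists p', p = 'X * p' /\ p %/ 'X = p'.
  move=> /eqP; rewrite -rootE -['X]subr0 => /factor_theorem[p' ->].
  by exists p'; rewrite mulrC subr0 mulrC mulpK ?polyX_eq0 // mulrC.
have cX (p : {poly R}) : coprimep 'X p = (p.[0] != 0).
  by rewrite coprimep_sym coprimepX rootE.
elim=> [|[p q] _ /= [cpq p0 q0]|[p q] _ /= [cpq p0 q0]].
- split=> /=.
  + by rewrite cX !hornerE oner_eq0.
  + by move=> i; rewrite coefX ler0n.
  + by move=> i; rewrite coefD coefX coef1 -natrD ler0n.
- rewrite /Phi0; case: ifPn => [/eqP /XE[p' [pE ->]]|pN0] /=.
    have p'0 i : 0 <= p'`_i by move: (p0 i.+1); rewrite pE coefXM.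
    split=> // [|i]; last by rewrite coefD addr_ge0.
    rewrite -[q in q + _]mul1r coprimep_addl_mul coprimep_sym.
    by apply: coprimep_dvdr cpq; rewrite pE dvdp_mull.
  split=> [|i|i]; [|by rewrite coefXM; case: ifP|by rewrite coefD coefXM addr_ge0//; case: ifP].
  rewrite -['X * q in X in coprimep _ X]mul1r coprimep_addl_mul coprimepMl cX pN0.
  by rewrite coprimep_sym.
- rewrite /Phi1; case: ifPn => [/eqP pv0|pN0] /=.
    have [p' [pE ->]] := XE _ pv0.
    have p'0 i : 0 <= p'`_i by move: (p0 i.+1); rewrite pE coefXM.
    split=> // [|i]; last by rewrite coefD addr_ge0.
    have qN0 : q.[0] != 0.
      have : coprimep 'X q by apply: coprimep_dvdr cpq; rewrite pE dvdp_mulr.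
      by rewrite cX.
    rewrite pE coprimepMl cX hornerD !horner_coef0 gt_eqF; last first.
      by rewrite ltr_wpDr// lt_neqAle q0 eq_sym -horner_coef0 qN0.
    rewrite addrC -[p' in p' + _]mul1r coprimep_addl_mul.
    by apply: coprimep_dvdr cpq; rewrite pE dvdp_mull.
  split=> [|i|i]; [|by rewrite coefXM; case: ifP|by rewrite coefD coefXM addr_ge0//; case: ifP].
  rewrite coprimepMl cX hornerD hornerM hornerX mul0r add0r pN0 /=.
  by rewrite addrC -[p in p + _]mul1r coprimep_addl_mul coprimepMr cpq coprimep_sym cX pN0.
Qed.

(* Main.v *)
Require Import Defs.
From HB Require Import structures.
From mathcomp Require Import all_boot all_order all_algebra.
From mathcomp Require Import all_classical all_reals all_analysis.
From mathcomp Require Import ring lra.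

Set Implicit Arguments.
Unset Strict Implicit.
Unset Printing Implicit Defensive.

Import Order.TTheory GRing.Theory Num.Theory.
Import numFieldNormedType.Exports.

Local Open Scope classical_set_scope.
Local Open Scope ring_scope.

(** As maps on rational functions, [Phi0 r = x / (x + r)] and
    [Phi1 r = x r / (x + r)], so for a fixed [x] both act on the vector
    [(p(x), q(x))] by matrices, up to a power of [x].  The word
    [Phi1^k o Phi0] acts by [(p, q) |-> (x q, (x + k) q + p)], whose
    characteristic polynomial is [l^2 - (x + k) l - x].  For [x <= -1] and
    [k = floor (- x)] its roots are [r e^(+- i t)] with [r = sqrt (- x)] and
    [x + k = 2 r cos t], [0 < t < pi].  If [n t = j pi], the denominator after
    [n] steps is [(-1)^j r^n q(x)].  As [t] varies near its initial value, two
    consecutive values of [j] occur once [n] is large, so either [q] or the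
    denominator after [n] steps changes sign near [x]. *)

(** * Evaluation of the tree maps at a nonzero point *)

Definition farey_step {R : realType} (k : nat) (v : ratpair R) : ratpair R :=
  iter k (@Phi1 R) (Phi0 v).

(** Stands in for [farey_step] without the case split on p(0): its pairs may fail to be in lowest
    terms, but they obey one linear recurrence. *)
Definition linear_step {R : realType} (k : nat) (v : ratpair R) : ratpair R :=
  ('X * v.2, ('X + k%:R%:P) * v.2 + v.1).

Lemma divp_X_eval (R : realType) (p : {poly R}) (x : R) :
  p.[0] = 0 -> x != 0 -> (p %/ 'X).[x] = x^-1 * p.[x].
Proof.
move=> p0 x0; have /divpK pE : 'X %| p.
  by rewrite -['X]subr0 -[0 in X in X %| _]/(0%:P) dvdp_XsubCl rootE p0.
by rewrite -[in RHS]pE hornerM hornerX mulrCA mulVf// mulr1.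
Qed.

Lemma Phi0_eval (R : realType) (v : ratpair R) (x : R) : x != 0 ->
  exists2 c : R, c != 0 &
    (Phi0 v).1.[x] = c * (x * v.2.[x]) /\
    (Phi0 v).2.[x] = c * (x * v.2.[x] + v.1.[x]).
Proof.
case: v => p q x0; rewrite /Phi0; case: ifPn => [/eqP p0|_] /=.
  exists x^-1; rewrite ?invr_eq0// hornerD divp_X_eval//.
  by split; field.
by exists 1; rewrite ?oner_eq0// !hornerE.
Qed.

Lemma Phi1_eval (R : realType) (v : ratpair R) (x : R) : x != 0 ->
  exists2 c : R, c != 0 &
    (Phi1 v).1.[x] = c * (x * v.1.[x]) /\
    (Phi1 v).2.[x] = c * (x * v.2.[x] + v.1.[x]).
Proof.
case: v => p q x0; rewrite /Phi1; case: ifPn => [/eqP p0|_] /=.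
  exists x^-1; rewrite ?invr_eq0// hornerD divp_X_eval//.
  by split; field.
by exists 1; rewrite ?oner_eq0// !hornerE.
Qed.

(** [Phi1] acts by x I + N with N^2 = 0, whose k-th power is x^(k-1) (x I + k N); hence the factor
    1/x at k = 0. *)
Lemma iter_Phi1_eval (R : realType) (v : ratpair R) (x : R) (k : nat) :
  x != 0 ->
  exists2 c : R, c != 0 &
    (iter k (@Phi1 R) v).1.[x] = c * (x * v.1.[x]) /\
    (iter k (@Phi1 R) v).2.[x] = c * (x * v.2.[x] + k%:R * v.1.[x]).
Proof.
move=> x0; elim: k => [|k [c c0 [E1 E2]]].
  by exists x^-1; rewrite ?invr_eq0//; split=> /=; field.
have [d d0 [F1 F2]] := Phi1_eval (iter k (@Phi1 R) v) x0.
exists (d * c * x); rewrite ?mulf_neq0//.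
by rewrite iterS F1 F2 E1 E2 -natr1; split; ring.
Qed.

Lemma farey_step_eval (R : realType) (v : ratpair R) (x : R) (k : nat) :
  x != 0 ->
  exists2 c : R, c != 0 &
    (farey_step k v).1.[x] = c * (linear_step k v).1.[x] /\
    (farey_step k v).2.[x] = c * (linear_step k v).2.[x].
Proof.
move=> x0; have [c c0 [E1 E2]] := iter_Phi1_eval (Phi0 v) k x0.
have [d d0 [F1 F2]] := Phi0_eval v x0.
exists (c * d * x); rewrite ?mulf_neq0// E1 E2 F1 F2 !hornerE/=.
by split; ring.
Qed.

Lemma iter_farey_step_eval (R : realType) (v : ratpair R) (x : R) (k n : nat) :
  x != 0 ->
  exists2 c : R, c != 0 &
    (iter n (farey_step k) v).1.[x] = c * (iter n (linear_step k) v).1.[x] /\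
    (iter n (farey_step k) v).2.[x] = c * (iter n (linear_step k) v).2.[x].
Proof.
move=> x0; elim: n => [|n [c c0 [E1 E2]]].
  by exists 1; rewrite ?oner_eq0// !mul1r.
have [d d0 [F1 F2]] := farey_step_eval (iter n (farey_step k) v) k x0.
exists (d * c); rewrite ?mulf_neq0// !iterS F1 F2 !hornerE/= E1 E2.
by split; ring.
Qed.

Lemma subtree_iter_farey_step (R : realType) (v : ratpair R) (k n : nat) :
  subtree v (iter n (farey_step k) v).
Proof.
elim: n => [|n IH]; first exact: subtree_root.
rewrite iterS; move: (iter n _ v) IH => w IH; rewrite /farey_step.
by elim: k => [|k IHk] /=; [exact: subtree_Phi0 | exact: subtree_Phi1].
Qed.

Lemma denom_zeros_linear_step (R : realType) (v : ratpair R) (x : R)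
    (k n : nat) :
  x != 0 -> (iter n (linear_step k) v).2.[x] = 0 -> denom_zeros v x.
Proof.
move=> x0 Q0; have [c _ [_ E]] := iter_farey_step_eval v k n x0.
have := subtree_iter_farey_step v k n.
move: E; case: (iter n (farey_step k) v) => p q /= E H.
by exists p, q; rewrite E Q0 mulr0.
Qed.

(** * Closed form of the iterates *)

(** The matrix has trace 2 r cos t and determinant r^2, so its powers have coefficients r^n sin (n
    t) / sin t, up to shifts of n. The numerator is carried along for the induction. *)
Lemma linear_step_trig (R : realType) (v : ratpair R) (x r t : R) (k n : nat) :
  x = - r ^+ 2 -> x + k%:R = 2 * r * cos t ->
  r * sin t * (iter n (linear_step k) v).2.[x] =
    r ^+ n * (r * v.2.[x] * sin (n%:R * t + t) + v.1.[x] * sin (n%:R * t)) /\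
  sin t * (iter n (linear_step k) v).1.[x] =
    - r ^+ n * (r * v.2.[x] * sin (n%:R * t) + v.1.[x] * sin (n%:R * t - t)).
Proof.
move=> xr xk; elim: n => [|n [IH2 IH1]].
  by rewrite !mul0r !add0r sin0 sinN expr0 /=; split; ring.
rewrite iterS /= !hornerE /= xk exprS.
have -> : n.+1%:R * t = n%:R * t + t by rewrite -natr1 mulrDl mul1r.
rewrite addrK.
have sin2 : sin (n%:R * t + t + t) =
    2 * cos t * sin (n%:R * t + t) - sin (n%:R * t).
  by rewrite !(sinD, cosD); ring: (sin2cos2 t).
have sinBt : sin (n%:R * t - t) = 2 * cos t * sin (n%:R * t) - sin (n%:R * t + t).
  by rewrite sinB sinD; ring.
rewrite sinBt in IH1; rewrite sin2; split.
  transitivity (2 * r * cos t * (r * sin t * (iter n (linear_step k) v).2.[x])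
    + r * (sin t * (iter n (linear_step k) v).1.[x])); first ring.
  by rewrite IH2 IH1; ring.
rewrite [in sin t * x]xr.
transitivity (- r * (r * sin t * (iter n (linear_step k) v).2.[x])); first ring.
by rewrite IH2; ring.
Qed.

Lemma sinDnatpi (R : realType) (t : R) (j : nat) :
  sin (j%:R * pi + t) = (-1) ^+ j * sin t.
Proof.
elim: j => [|j IH]; first by rewrite mul0r add0r mul1r.
rewrite -natr1 mulrDl mul1r addrAC sinDpi IH exprS; ring.
Qed.

Lemma linear_step_natpi (R : realType) (v : ratpair R) (x r t : R)
    (k n j : nat) :
  x = - r ^+ 2 -> x + k%:R = 2 * r * cos t -> r != 0 -> sin t != 0 ->
  n%:R * t = j%:R * pi ->
  (iter n (linear_step k) v).2.[x] = (-1) ^+ j * r ^+ n * v.2.[x].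
Proof.
move=> xr xk r0 s0 nt; have [] := linear_step_trig v n xr xk.
rewrite nt sinDnatpi -[j%:R * pi]addr0 sinDnatpi sin0 mulr0 mulr0 addr0 => E _.
by apply: (mulfI (mulf_neq0 r0 s0)); rewrite E; ring.
Qed.

(** * Intermediate values and rotation angles *)

Lemma poly_root_ball (R : realType) (p : {poly R}) (x0 e a b : R) :
  ball x0 e a -> ball x0 e b -> p.[a] * p.[b] <= 0 ->
  exists2 x, ball x0 e x & p.[x] = 0.
Proof.
wlog ab : a b / a <= b => [hw ba bb|].
  have [ab|/ltW ab] := leP a b; first exact: hw ab ba bb.
  by rewrite mulrC; exact: hw ab bb ba.
rewrite -!ball_normE /ball_ /= !ltr_distlC => /andP[a1 a2] /andP[b1 b2] pab.
have [x /andP[ax xb] /rootP px] : exists2 x, a <= x <= b & root p x.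
  have [pa|pa] := leP p.[a] 0.
    have [pb|pb] := leP 0 p.[b]; first by apply: poly_ivt; rewrite // pa.
    have pa0 : p.[a] = 0 by nra.
    by exists a; rewrite ?lexx// rootE pa0.
  have pb : p.[b] <= 0 by nra.
  have [x xab] : exists2 x, a <= x <= b & root (- p) x.
    by apply: poly_ivt; rewrite // !hornerN; apply/andP; split; lra.
  by rewrite rootN; exists x.
by exists x => //; rewrite ltr_distlC; lra.
Qed.

(** The nonpositive [x] for which the matrix of [Phi1^k o Phi0] has rotation
    angle [t] is [- rotation_modulus k t ^+ 2]. *)
Definition rotation_modulus {R : realType} (k : nat) (t : R) : R :=
  Num.sqrt (cos t ^+ 2 + k%:R) - cos t.

(** [rotation_modulus k t] is the larger root in r of r^2 + 2 r cos t - k = 0. *)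
Lemma rotation_modulusE (R : realType) (k : nat) (t : R) :
  let r := rotation_modulus k t in - r ^+ 2 + k%:R = 2 * r * cos t.
Proof.
have H : Num.sqrt (cos t ^+ 2 + k%:R) ^+ 2 = cos t ^+ 2 + k%:R.
  by rewrite sqr_sqrtr// addr_ge0// sqr_ge0.
by rewrite /rotation_modulus /=; ring: H.
Qed.

Lemma rotation_modulus_gt0 (R : realType) (k : nat) (t : R) :
  (0 < k)%N -> 0 < rotation_modulus k t.
Proof.
move=> k0; rewrite subr_gt0 (le_lt_trans (ler_norm _))// -sqrtr_sqr ltr_sqrt.
  by rewrite ltrDl ltr0n.
by rewrite ltr_wpDl ?sqr_ge0// ltr0n.
Qed.

Lemma continuous_rotation_modulus (R : realType) (k : nat) :
  continuous (@rotation_modulus R k).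
Proof.
move=> t; apply: cvgB; last exact: continuous_cos.
apply: (@continuous_comp _ _ _ (fun t => cos t ^+ 2 + k%:R) Num.sqrt).
  apply: cvgD; last exact: cvg_cst.
  by apply: cvgM; exact: continuous_cos.
exact: sqrt_continuous.
Qed.

Lemma rotation_modulus_surj (R : realType) (x : R) : x <= -1 ->
  exists k t, [/\ (0 < k)%N, 0 < t < pi & x = - rotation_modulus k t ^+ 2].
Proof.
move=> x1; pose k := Num.truncn (- x); pose r := Num.sqrt (- x).
have /andP[kx xk] : k%:R <= - x < k.+1%:R by apply: truncn_itv; lra.
have r2 : r ^+ 2 = - x by rewrite sqr_sqrtr; lra.
have r1 : 1 <= r by rewrite -sqrtr1 ler_sqrt; lra.
rewrite -natr1 in xk.
pose c := (x + k%:R) / (2 * r).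
have cE : 2 * r * c = x + k%:R by rewrite /c; field; rewrite gt_eqF; lra.
(* Since -1 < x + k <= 0 and r >= 1, c even lies in (-1/2, 0]. *)
have c1 : -1 < c < 1 by apply/andP; split; nra.
have cc : -1 <= c <= 1 by lra.
exists k, (acos c); split.
- by rewrite truncn_gt0; lra.
- by rewrite acos_gt0 ?acos_ltpi//; lra.
rewrite /rotation_modulus acosK ?in_itv//=.
have -> : c ^+ 2 + k%:R = (r + c) ^+ 2
  by rewrite sqrrD r2 -[k%:R](addKr x) -cE; ring.
by rewrite sqrtr_sqr ger0_norm ?addrK ?r2 ?opprK//; lra.
Qed.

(** For n > pi / e the multiples of pi / n are less than e apart, so the two that enclose t are both
    within e of it. *)
Lemma consecutive_natpi_in_ball (R : realType) (t e : R) : 0 < t -> 0 < e ->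
  exists n j : nat, [/\ (0 < n)%N, ball t e (j%:R * pi / n%:R) &
    ball t e (j.+1%:R * pi / n%:R)].
Proof.
move=> t0 e0; have p0 := pi_gt0 R.
pose n := (Num.truncn (pi / e)).+1.
have n0 : 0 < n%:R :> R by rewrite ltr0n.
have ne : pi < n%:R * e by rewrite -ltr_pdivrMr// /n; exact: truncnS_gt.
pose j := Num.truncn (n%:R * t / pi).
have /andP[] : j%:R <= n%:R * t / pi < j.+1%:R.
  by apply: truncn_itv; rewrite divr_ge0 ?mulr_ge0// ltW.
rewrite ler_pdivlMr// ltr_pdivrMr// => jn nj.
exists n, j; rewrite -!ball_normE /ball_ /= !ltr_distlC.
rewrite !ltr_pdivlMr// !ltr_pdivrMr//.
by move: nj; rewrite -natr1 => nj; split=> //; apply/andP; split; nra.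
Qed.

Lemma denom_zeros_dense (R : realType) (v : ratpair R) :
  [set x : R | x <= -1] `<=` closure (denom_zeros v).
Proof.
move=> x0 /= x01 B /nbhs_ballP[e /= e0 eB].
have [k [t0 [k0 /andP[t00 t0pi] x0E]]] := rotation_modulus_surj x01.
(* k stays fixed while t varies, so a single polynomial, the denominator after n steps, is evaluated
   at all the points h t. *)
pose h (t : R) := - rotation_modulus k t ^+ 2.
have hcont : h @ t0 --> x0.
  rewrite x0E; apply: cvgN.
  by apply: cvgM; exact: continuous_rotation_modulus.
(* Radius at most 1 keeps the open ball around x0 <= -1 away from 0, where the evaluation lemmas
   fail. *)
pose e' := Num.min e 1.
have e'0 : 0 < e' by rewrite lt_min e0 ltr01.
have /nbhs_ballP[d /= d0 dP] :
    \forall t \near t0, ball x0 e' (h t) /\ 0 < t < pi.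
  near=> t; split; first by near: t; exact/hcont/nbhsx_ballx.
  by apply/andP; split; near: t; [exact: lt_nbhsr|exact: lt_nbhsl].
have [n [j [n0 /dP[ha ta] /dP[hb tb]]]] := consecutive_natpi_in_ball t00 d0.
have Qn (i : nat) (t := i%:R * pi / n%:R) : 0 < t < pi ->
    (iter n (linear_step k) v).2.[h t] =
      (-1) ^+ i * rotation_modulus k t ^+ n * v.2.[h t].
  move=> tpi; apply: linear_step_natpi => //.
  - exact: rotation_modulusE.
  - by rewrite gt_eqF// rotation_modulus_gt0.
  - by rewrite gt_eqF// sin_gt0_pi.
  - by rewrite mulrC divfK// pnatr_eq0 -lt0n.
have [m [x xe Qx]] : exists m, exists2 x, ball x0 e' x &
    (iter m (linear_step k) v).2.[x] = 0.
  set ya := h _ in ha; set yb := h _ in hb.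
  have [qab|qab] := leP (v.2.[ya] * v.2.[yb]) 0.
    by exists 0%N; exact: poly_root_ball ha hb qab.
  (* Here q has the same strict sign at both points, while (-1)^j and (-1)^(j+1) differ, so the
     denominator after n steps changes sign. *)
  exists n; apply: poly_root_ball ha hb _; rewrite Qn// Qn//.
  set ra := _ ^+ n; set rb := rotation_modulus _ _ ^+ n.
  have ra0 : 0 < ra by rewrite exprn_gt0// rotation_modulus_gt0.
  have rb0 : 0 < rb by rewrite exprn_gt0// rotation_modulus_gt0.
  have -> : (-1) ^+ j * ra * v.2.[ya] * ((-1) ^+ j.+1 * rb * v.2.[yb]) =
      - ((-1) ^+ j) ^+ 2 * (ra * rb * (v.2.[ya] * v.2.[yb])).
    by rewrite exprS; ring.
  by rewrite sqrr_sign mulN1r oppr_le0 mulr_ge0 ?ltW// mulr_gt0.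
exists x; split.
  apply: denom_zeros_linear_step Qx.
  have e'1 : e' <= 1 by rewrite ge_min lexx orbT.
  move: xe; rewrite -ball_normE /ball_ /= ltr_distlC => xe.
  by rewrite lt_eqF//; lra.
apply: eB; apply: le_ball xe; by rewrite ge_min lexx.
Unshelve. all: by end_near.
Qed.

Theorem theorem1p2 (R : realType) (a : seq nat)
    (a_nonempty : a != [::])
    (a_pos : all (fun ai => 0 < ai)%N a)
    (a_vertex : farey_vertex (farey_label R a)) :
  [set x : R | x <= -1] `<=` closure (denom_zeros (farey_label R a)).
Proof. exact: denom_zeros_dense. Qed.
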